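(* Let $\mathcal{O}$ be an $\mathcal{SH}$ ontology in NNF, and let $\mathcal{O}'$ be the $\mathcal{EL}^\rightarrow$ ontology obtained from $\mathcal{O}$ by replacing $\forall$, $\sqcup$ and $\neg$ with $\bar\forall$, $\bar\sqcup$ and $\bar\neg$ respectively. If $\mathcal{O}$ is (set-theoretically) consistent, then $\mathcal{O}'$ is (categorically) $\mathcal{EL}^\rightarrow$-consistent.
   Context: $\mathcal{SH}$: concepts $\top,\bot,A,C\sqcap D,C\sqcup D,\neg C,\exists R.C,\forall R.C$; an ontology is a finite set of GCIs $C\sqsubseteq D$, role inclusions $R\sqsubseteq S$, transitivity axioms $S\circ S\sqsubseteq S$, concept assertions $\{a\}\sqsubseteq C$, role assertions $\{(a,b)\}\sqsubseteq R$, with standard Tarskian semantics; consistency means having a model. NNF: negation only in front of concept names. $\mathcal{EL}^{\rightarrow}$: same syntax with $\bar\sqcup,\bar\neg,\bar\forall$ in place of $\sqcup,\neg,\forall$, ontologies in NNF. Categorical saturation: one builds a concept structure and a role structure (sets of objects with a binary arrow relation $\rightarrow$). Concept objects are formal expressions (concepts, individual objects $\{a\}$, and $\Pi_\ell(R),\Pi_r(R)$ for role objects $R$), identified up to associativity, commutativity and idempotence of $\sqcap$ and $\bar\sqcup$; role objects are role names, $\{(a,b)\}$, $\mathfrak R_\top,\mathfrak R_\bot$, $S\circ S$, and a fresh $\mathfrak R_{(\exists R.C)}$ for each object $\exists R.C$. Initially: $\top,\bot$, concept names, $\{a\}$ for individuals, $\mathfrak R_\top,\mathfrak R_\bot$,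 role names; adding an arrow adds its endpoints. $X\leftrightarrows Y$ means $X\rightarrow Y$ and $Y\rightarrow X$. Rules applied until none adds anything: (it) concept object $X$: $X\rightarrow\top,\bot\rightarrow X,X\rightarrow X$; role object $X$: $X\rightarrow\mathfrak R_\top,\mathfrak R_\bot\rightarrow X,X\rightarrow X$; (r) role object $R$ $\Rightarrow$ objects $\Pi_\ell(R),\Pi_r(R)$; (tr) $X\rightarrow Y\rightarrow Z$ $\Rightarrow$ $X\rightarrow Z$; (f) $\Pi_\ell(R)\rightarrow\bot$ $\Rightarrow$ $\Pi_r(R)\rightarrow\bot$ and conversely; (ax) each axiom $X\sqsubseteq Y\in\mathcal O$ gives $X\rightarrow Y$ (concept arrow for GCIs and concept assertions, role arrow for role axioms); ($\sqcap$d) object $C\sqcap D$ $\Rightarrow$ $C\sqcap D\rightarrow C$, $C\sqcap D\rightarrow D$; ($\sqcap$c) $X\rightarrow C$, $X\rightarrow D$, object $C\sqcap D$ $\Rightarrow$ $X\rightarrow C\sqcap D$; ($\sqcup$d) $C\bar\sqcup D\rightarrow X$ $\Rightarrow$ $C\rightarrow X$, $D\rightarrow X$; ($\sqcup$c) $C\rightarrow X$, $D\rightarrow X$, object $C\bar\sqcup D$ $\Rightarrow$ $C\bar\sqcup D\rightarrow X$; ($\neg$) $X\rightarrow A$, $X\rightarrow\bar\neg A$ $\Rightarrow$ $X\rightarrow\bot$; ($\exists$) object $\exists R.C$ $\Rightarrow$ object $C$, $\mathfrak R_{(\exists R.C)}\rightarrow R$, $\exists R.C\leftrightarrows\Pi_\ell(\mathfrak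 R_{(\exists R.C)})$, $\Pi_r(\mathfrak R_{(\exists R.C)})\rightarrow C$; ($\exists$H) object $\exists R.C$, $R'\rightarrow R$, $\Pi_r(R')\rightarrow C$ $\Rightarrow$ $\Pi_\ell(R')\rightarrow\Pi_\ell(\mathfrak R_{(\exists R.C)})$; ($\exists\circ$) $S\circ S\rightarrow S$, $X\rightarrow\exists S.C$, $C\rightarrow\exists S.D$ $\Rightarrow$ $X\rightarrow\exists S.D$; ($\exists\bar\forall$) $X\rightarrow\exists P.C$, $X\rightarrow\bar\forall R.D$, $P\rightarrow R$ $\Rightarrow$ object $C\sqcap D$; ($\exists\forall$) $X\rightarrow\exists P.C$, $X\rightarrow\bar\forall R.D$, $P\rightarrow R$, $C\sqcap D\rightarrow\bot$ $\Rightarrow$ $X\rightarrow\bot$; ($\exists\forall$I) $\{(a,b)\}\rightarrow P$, $\{a\}\rightarrow\bar\forall R.D$, $P\rightarrow R$ $\Rightarrow$ $\{a\}\rightarrow\exists P.D$, $\{b\}\rightarrow D$; ($\exists\circ\bar\forall$) $P\rightarrow S$, $S\circ S\rightarrow S$, $S\rightarrow R$, $X\rightarrow\exists P.C$, $X\rightarrow\bar\forall R.D$ $\Rightarrow$ object $C\sqcap\bar\forall S.D$; ($\exists\circ\forall$) the same premises plus $C\sqcap\bar\forall S.D\rightarrow\bot$ $\Rightarrow$ $X\rightarrow\bot$; ($\exists\circ\forall$I) $P\rightarrow S$, $S\circ S\rightarrow S$, $S\rightarrow R$, $\{(a,b)\}\rightarrow P$, $\{a\}\rightarrow\bar\forall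 R.D$ $\Rightarrow$ $\{a\}\rightarrow\exists P.\bar\forall S.D$, $\{b\}\rightarrow\bar\forall S.D$. $\mathcal O'$ is $\mathcal{EL}^\rightarrow$-inconsistent iff the saturated concept structure contains $\{a\}\rightarrow\bot$ for some individual $a$, and $\mathcal{EL}^\rightarrow$-consistent otherwise. *)

(* Defs.v *)
(* Throughout, NC, NR, NI are the sets of concept names, role names and
   individuals. *)
From Stdlib Require Import List.

Set Implicit Arguments.
Unset Strict Implicit.
Unset Printing Implicit Defensive.

(** * Axioms and ontologies, over an arbitrary language [Cpt] of concepts *)

Inductive axiom (NR NI Cpt : Type) : Type :=
| GCI (C D : Cpt)                       (* C [= D *)
| RoleIncl (R S : NR)                   (* R [= S *)
| Trans (S : NR)                        (* S o S [= S *)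
| ConceptAssert (a : NI) (C : Cpt)      (* {a} [= C *)
| RoleAssert (a b : NI) (R : NR).       (* {(a,b)} [= R *)
Arguments RoleIncl {NR NI Cpt} R S.
Arguments Trans {NR NI Cpt} S.
Arguments GCI {NR NI Cpt} C D.
Arguments ConceptAssert {NR NI Cpt} a C.
Arguments RoleAssert {NR NI Cpt} a b R.

(* A finite set of axioms: order and multiplicity in the list are never used. *)
Definition ontology (NR NI Cpt : Type) : Type := list (axiom NR NI Cpt).

(** * The description logic SH *)

Inductive sh_concept (NC NR : Type) : Type :=
| Top
| Bot
| Name (A : NC)
| And (C D : sh_concept NC NR)
| Or (C D : sh_concept NC NR)
| Not (C : sh_concept NC NR)
| Ex (R : NR) (C : sh_concept NC NR)
| All (R : NR) (C : sh_concept NC NR).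
Arguments Top {NC NR}.
Arguments Bot {NC NR}.
Arguments Name {NC NR} A.

Definition sh_ontology (NC NR NI : Type) : Type :=
  ontology NR NI (sh_concept NC NR).

(* No unique name assumption. *)
Record interp (NC NR NI : Type) : Type := Interp {
  dom : Type;
  dom_inhabited : inhabited dom;
  iconcept : NC -> dom -> Prop;
  irole : NR -> dom -> dom -> Prop;
  iindiv : NI -> dom
}.

Fixpoint denote (NC NR NI : Type) (I : interp NC NR NI) (C : sh_concept NC NR)
    : dom I -> Prop :=
  match C with
  | Top => fun _ => True
  | Bot => fun _ => False
  | Name A => iconcept A
  | And C D => fun x => denote C x /\ denote D x
  | Or C D => fun x => denote C x \/ denote D x
  | Not C => fun x => ~ denote C x
  | Ex R C => fun x => exists y, irole R x y /\ denote C y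
  | All R C => fun x => forall y, irole R x y -> denote C y
  end.

Definition satisfies (NC NR NI : Type) (I : interp NC NR NI)
    (ax : axiom NR NI (sh_concept NC NR)) : Prop :=
  match ax with
  | GCI C D => forall x : dom I, denote C x -> denote D x
  | RoleIncl R P => forall x y : dom I, irole R x y -> irole P x y
  | Trans R => forall x y z : dom I, irole R x y -> irole R y z -> irole R x z
  | ConceptAssert a C => denote C (iindiv I a)
  | RoleAssert a b R => irole R (iindiv I a) (iindiv I b)
  end.

Definition is_model (NC NR NI : Type) (I : interp NC NR NI)
    (O : sh_ontology NC NR NI) : Prop :=
  forall ax, In ax O -> satisfies I ax.

Definition sh_consistent (NC NR NI : Type) (O : sh_ontology NC NR NI) : Prop :=
  exists I : interp NC NR NI, is_model I O.

Fixpoint nnf (NC NR : Type) (C : sh_concept NC NR) : Prop :=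
  match C with
  | Top | Bot | Name _ => True
  | And C D | Or C D => nnf C /\ nnf D
  | Not (Name _) => True
  | Not _ => False
  | Ex _ C | All _ C => nnf C
  end.

Definition nnf_axiom (NC NR NI : Type) (ax : axiom NR NI (sh_concept NC NR))
    : Prop :=
  match ax with
  | GCI C D => nnf C /\ nnf D
  | ConceptAssert _ C => nnf C
  | RoleIncl _ _ | Trans _ | RoleAssert _ _ _ => True
  end.

Definition nnf_ontology (NC NR NI : Type) (O : sh_ontology NC NR NI) : Prop :=
  forall ax, In ax O -> nnf_axiom ax.

(** * The logic EL-> *)

(* [EOr], [ENot], [EAll] are the barred constructors. *)
Inductive el_concept (NC NR : Type) : Type :=
| ETop
| EBot
| EName (A : NC)
| EAnd (C D : el_concept NC NR)
| EOr (C D : el_concept NC NR)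
| ENot (C : el_concept NC NR)
| EEx (R : NR) (C : el_concept NC NR)
| EAll (R : NR) (C : el_concept NC NR).
Arguments ETop {NC NR}.
Arguments EBot {NC NR}.
Arguments EName {NC NR} A.

Definition el_ontology (NC NR NI : Type) : Type :=
  ontology NR NI (el_concept NC NR).

Fixpoint bar (NC NR : Type) (C : sh_concept NC NR) : el_concept NC NR :=
  match C with
  | Top => ETop
  | Bot => EBot
  | Name A => EName A
  | And C D => EAnd (bar C) (bar D)
  | Or C D => EOr (bar C) (bar D)
  | Not C => ENot (bar C)
  | Ex R C => EEx R (bar C)
  | All R C => EAll R (bar C)
  end.

Definition bar_axiom (NC NR NI : Type) (ax : axiom NR NI (sh_concept NC NR))
    : axiom NR NI (el_concept NC NR) :=
  match ax with
  | GCI C D => GCI (bar C) (bar D)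
  | RoleIncl R P => RoleIncl R P
  | Trans R => Trans R
  | ConceptAssert a C => ConceptAssert a (bar C)
  | RoleAssert a b R => RoleAssert a b R
  end.

Definition bar_ontology (NC NR NI : Type) (O : sh_ontology NC NR NI)
    : el_ontology NC NR NI := map (@bar_axiom NC NR NI) O.

(** * Objects of the concept and role structures *)

Inductive robj (NC NR NI : Type) : Type :=
| RName (R : NR)
| RPair (a b : NI)                          (* {(a,b)} *)
| RTop
| RBot
| RComp (S : NR)                            (* S o S *)
| RFresh (R : NR) (C : el_concept NC NR).   (* R_(exists R.C) *)
Arguments RName {NC NR NI} R.
Arguments RPair {NC NR NI} a b.
Arguments RTop {NC NR NI}.
Arguments RBot {NC NR NI}.
Arguments RComp {NC NR NI} S.
Arguments RFresh {NC NR NI} R C.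

Inductive cobj (NC NR NI : Type) : Type :=
| OConcept (C : el_concept NC NR)
| OIndiv (a : NI)                           (* {a} *)
| OPiL (R : robj NC NR NI)
| OPiR (R : robj NC NR NI).
Arguments OConcept {NC NR NI} C.
Arguments OIndiv {NC NR NI} a.

(* Objects are identified up to associativity, commutativity and idempotence of
   [EAnd] and [EOr] at any depth: [concept_aci] is the congruence generated by
   these laws, lifted to role and concept objects by [robj_aci], [cobj_aci]. *)
Inductive concept_aci (NC NR : Type)
    : el_concept NC NR -> el_concept NC NR -> Prop :=
| aci_refl C : concept_aci C C
| aci_sym C D : concept_aci C D -> concept_aci D C
| aci_trans C D E : concept_aci C D -> concept_aci D E -> concept_aci C E
| aci_andA C D E : concept_aci (EAnd C (EAnd D E)) (EAnd (EAnd C D) E)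
| aci_andC C D : concept_aci (EAnd C D) (EAnd D C)
| aci_andI C : concept_aci (EAnd C C) C
| aci_orA C D E : concept_aci (EOr C (EOr D E)) (EOr (EOr C D) E)
| aci_orC C D : concept_aci (EOr C D) (EOr D C)
| aci_orI C : concept_aci (EOr C C) C
| aci_and C C' D D' : concept_aci C C' -> concept_aci D D' ->
    concept_aci (EAnd C D) (EAnd C' D')
| aci_or C C' D D' : concept_aci C C' -> concept_aci D D' ->
    concept_aci (EOr C D) (EOr C' D')
| aci_not C C' : concept_aci C C' -> concept_aci (ENot C) (ENot C')
| aci_ex R C C' : concept_aci C C' -> concept_aci (EEx R C) (EEx R C')
| aci_all R C C' : concept_aci C C' -> concept_aci (EAll R C) (EAll R C').

Inductive robj_aci (NC NR NI : Type) : robj NC NR NI -> robj NC NR NI -> Prop :=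
| robj_aci_refl R : robj_aci R R
| robj_aci_fresh R C C' : concept_aci C C' ->
    robj_aci (RFresh R C) (RFresh R C').

Inductive cobj_aci (NC NR NI : Type) : cobj NC NR NI -> cobj NC NR NI -> Prop :=
| cobj_aci_refl X : cobj_aci X X
| cobj_aci_concept C C' : concept_aci C C' ->
    cobj_aci (OConcept C) (OConcept C')
| cobj_aci_piL R R' : robj_aci R R' -> cobj_aci (OPiL R) (OPiL R')
| cobj_aci_piR R R' : robj_aci R R' -> cobj_aci (OPiR R) (OPiR R').

(** * Categorical saturation *)

(* The saturated concept structure ([cob] its objects, [carr] its arrows) and
   role structure ([rob], [rarr]) of [O].  All the rules being monotone, the
   result of applying them until nothing is added is the least structure closed
   under them, i.e. this inductive definition.  The [_aci] constructors make the
   four predicates well defined on classes of identified objects.  The other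
   constructors are named after the saturation rules: it, r, tr, f, ax, and_d,
   and_c, or_d, or_c, not, ex, exH, exo, ex_barall, ex_all, ex_allI, exo_barall,
   exo_all, exo_allI; [init] marks the initial objects, and [src], [tgt] add the
   endpoints of arrows. *)
Inductive cob (NC NR NI : Type) (O : el_ontology NC NR NI)
    : cobj NC NR NI -> Prop :=
| cob_aci X X' : cobj_aci X X' -> cob O X -> cob O X'
| cob_init_top : cob O (OConcept ETop)
| cob_init_bot : cob O (OConcept EBot)
| cob_init_name A : cob O (OConcept (EName A))
| cob_init_indiv a : cob O (OIndiv a)
| cob_src X Y : carr O X Y -> cob O X
| cob_tgt X Y : carr O X Y -> cob O Y
| cob_r_piL R : rob O R -> cob O (OPiL R)
| cob_r_piR R : rob O R -> cob O (OPiR R)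
| cob_ex R C : cob O (OConcept (EEx R C)) -> cob O (OConcept C)
| cob_ex_barall X P R C D :
    carr O X (OConcept (EEx P C)) ->
    carr O X (OConcept (EAll R D)) ->
    rarr O (RName P) (RName R) ->
    cob O (OConcept (EAnd C D))
| cob_exo_barall X P S R C D :
    rarr O (RName P) (RName S) ->
    rarr O (RComp S) (RName S) ->
    rarr O (RName S) (RName R) ->
    carr O X (OConcept (EEx P C)) ->
    carr O X (OConcept (EAll R D)) ->
    cob O (OConcept (EAnd C (EAll S D)))

with rob (NC NR NI : Type) (O : el_ontology NC NR NI) : robj NC NR NI -> Prop :=
| rob_aci R R' : robj_aci R R' -> rob O R -> rob O R'
| rob_init_top : rob O RTop
| rob_init_bot : rob O RBot
| rob_init_name R : rob O (RName R)
| rob_src R S : rarr O R S -> rob O R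
| rob_tgt R S : rarr O R S -> rob O S

with carr (NC NR NI : Type) (O : el_ontology NC NR NI)
    : cobj NC NR NI -> cobj NC NR NI -> Prop :=
| carr_aci X X' Y Y' :
    cobj_aci X X' -> cobj_aci Y Y' -> carr O X Y -> carr O X' Y'
| carr_it_top X : cob O X -> carr O X (OConcept ETop)
| carr_it_bot X : cob O X -> carr O (OConcept EBot) X
| carr_it_id X : cob O X -> carr O X X
| carr_tr X Y Z : carr O X Y -> carr O Y Z -> carr O X Z
| carr_f_lr R : carr O (OPiL R) (OConcept EBot) -> carr O (OPiR R) (OConcept EBot)
| carr_f_rl R : carr O (OPiR R) (OConcept EBot) -> carr O (OPiL R) (OConcept EBot)
| carr_ax_gci C D : In (GCI C D) O -> carr O (OConcept C) (OConcept D)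
| carr_ax_assert a C : In (ConceptAssert a C) O -> carr O (OIndiv a) (OConcept C)
| carr_and_d_l C D :
    cob O (OConcept (EAnd C D)) -> carr O (OConcept (EAnd C D)) (OConcept C)
| carr_and_d_r C D :
    cob O (OConcept (EAnd C D)) -> carr O (OConcept (EAnd C D)) (OConcept D)
| carr_and_c X C D :
    carr O X (OConcept C) -> carr O X (OConcept D) ->
    cob O (OConcept (EAnd C D)) ->
    carr O X (OConcept (EAnd C D))
| carr_or_d_l X C D : carr O (OConcept (EOr C D)) X -> carr O (OConcept C) X
| carr_or_d_r X C D : carr O (OConcept (EOr C D)) X -> carr O (OConcept D) X
| carr_or_c X C D :
    carr O (OConcept C) X -> carr O (OConcept D) X ->
    cob O (OConcept (EOr C D)) ->
    carr O (OConcept (EOr C D)) X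
| carr_not X A :
    carr O X (OConcept (EName A)) -> carr O X (OConcept (ENot (EName A))) ->
    carr O X (OConcept EBot)
| carr_ex_piL R C :
    cob O (OConcept (EEx R C)) ->
    carr O (OConcept (EEx R C)) (OPiL (RFresh R C))
| carr_ex_piL_inv R C :
    cob O (OConcept (EEx R C)) ->
    carr O (OPiL (RFresh R C)) (OConcept (EEx R C))
| carr_ex_piR R C :
    cob O (OConcept (EEx R C)) ->
    carr O (OPiR (RFresh R C)) (OConcept C)
| carr_exH R C R' :
    cob O (OConcept (EEx R C)) ->
    rarr O R' (RName R) ->
    carr O (OPiR R') (OConcept C) ->
    carr O (OPiL R') (OPiL (RFresh R C))
| carr_exo X S C D :
    rarr O (RComp S) (RName S) ->
    carr O X (OConcept (EEx S C)) ->
    carr O (OConcept C) (OConcept (EEx S D)) ->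
    carr O X (OConcept (EEx S D))
| carr_ex_all X P R C D :
    carr O X (OConcept (EEx P C)) ->
    carr O X (OConcept (EAll R D)) ->
    rarr O (RName P) (RName R) ->
    carr O (OConcept (EAnd C D)) (OConcept EBot) ->
    carr O X (OConcept EBot)
| carr_ex_allI_src a b P R D :
    rarr O (RPair a b) (RName P) ->
    carr O (OIndiv a) (OConcept (EAll R D)) ->
    rarr O (RName P) (RName R) ->
    carr O (OIndiv a) (OConcept (EEx P D))
| carr_ex_allI_tgt a b P R D :
    rarr O (RPair a b) (RName P) ->
    carr O (OIndiv a) (OConcept (EAll R D)) ->
    rarr O (RName P) (RName R) ->
    carr O (OIndiv b) (OConcept D)
| carr_exo_all X P S R C D :
    rarr O (RName P) (RName S) ->
    rarr O (RComp S) (RName S) ->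
    rarr O (RName S) (RName R) ->
    carr O X (OConcept (EEx P C)) ->
    carr O X (OConcept (EAll R D)) ->
    carr O (OConcept (EAnd C (EAll S D))) (OConcept EBot) ->
    carr O X (OConcept EBot)
| carr_exo_allI_src a b P S R D :
    rarr O (RName P) (RName S) ->
    rarr O (RComp S) (RName S) ->
    rarr O (RName S) (RName R) ->
    rarr O (RPair a b) (RName P) ->
    carr O (OIndiv a) (OConcept (EAll R D)) ->
    carr O (OIndiv a) (OConcept (EEx P (EAll S D)))
| carr_exo_allI_tgt a b P S R D :
    rarr O (RName P) (RName S) ->
    rarr O (RComp S) (RName S) ->
    rarr O (RName S) (RName R) ->
    rarr O (RPair a b) (RName P) ->
    carr O (OIndiv a) (OConcept (EAll R D)) ->
    carr O (OIndiv b) (OConcept (EAll S D))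

with rarr (NC NR NI : Type) (O : el_ontology NC NR NI)
    : robj NC NR NI -> robj NC NR NI -> Prop :=
| rarr_aci R R' S S' :
    robj_aci R R' -> robj_aci S S' -> rarr O R S -> rarr O R' S'
| rarr_it_top R : rob O R -> rarr O R RTop
| rarr_it_bot R : rob O R -> rarr O RBot R
| rarr_it_id R : rob O R -> rarr O R R
| rarr_tr R S T : rarr O R S -> rarr O S T -> rarr O R T
| rarr_ax_incl R S : In (RoleIncl R S) O -> rarr O (RName R) (RName S)
| rarr_ax_trans S : In (Trans S) O -> rarr O (RComp S) (RName S)
| rarr_ax_assert a b R : In (RoleAssert a b R) O -> rarr O (RPair a b) (RName R)
| rarr_ex R C : cob O (OConcept (EEx R C)) -> rarr O (RFresh R C) (RName R).

Definition el_inconsistent (NC NR NI : Type) (O : el_ontology NC NR NI) : Prop :=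
  exists a : NI, carr O (OIndiv a) (OConcept EBot).

Definition el_consistent (NC NR NI : Type) (O : el_ontology NC NR NI) : Prop :=
  ~ el_inconsistent O.

(* Main.v *)
(** Soundness of saturation.  Any model of the ontology interprets every object:
    concepts as usual (the barred constructors like the unbarred ones), [S o S]
    as composition, [R_(exists R.C)] as [R] with range restricted to [C], and
    [Pi_l], [Pi_r] as domain and range.  Every saturation rule then produces an
    arrow that is an inclusion in the model, and no inclusion sends the nonempty
    [{a}] into the empty [bot]. *)
From Stdlib Require Import List.
Require Import Defs.

Set Implicit Arguments.
Unset Strict Implicit.

Fixpoint el_denote (NC NR NI : Type) (I : interp NC NR NI)
    (C : el_concept NC NR) : dom I -> Prop :=
  match C with
  | ETop => fun _ => True
  | EBot => fun _ => False
  | EName A => iconcept A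
  | EAnd C D => fun x => el_denote C x /\ el_denote D x
  | EOr C D => fun x => el_denote C x \/ el_denote D x
  | ENot C => fun x => ~ el_denote C x
  | EEx R C => fun x => exists y, irole R x y /\ el_denote C y
  | EAll R C => fun x => forall y, irole R x y -> el_denote C y
  end.

Definition robj_denote (NC NR NI : Type) (I : interp NC NR NI)
    (R : robj NC NR NI) (x y : dom I) : Prop :=
  match R with
  | RName R => irole R x y
  | RPair a b => x = iindiv I a /\ y = iindiv I b
  | RTop => True
  | RBot => False
  | RComp P => exists z, irole P x z /\ irole P z y
  | RFresh R C => irole R x y /\ el_denote C y
  end.

Definition cobj_denote (NC NR NI : Type) (I : interp NC NR NI)
    (X : cobj NC NR NI) (x : dom I) : Prop :=
  match X with
  | OConcept C => el_denote C x
  | OIndiv a => x = iindiv I a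
  | OPiL R => exists y, robj_denote R x y
  | OPiR R => exists y, robj_denote R y x
  end.

Section Soundness.

Variables (NC NR NI : Type) (I : interp NC NR NI).

Lemma el_denote_bar (C : sh_concept NC NR) (x : dom I) :
  el_denote (bar C) x <-> denote C x.
Proof.
  revert x; induction C; intro x; simpl; firstorder.
Qed.

Lemma el_denote_aci (C D : el_concept NC NR) :
  concept_aci C D -> forall x : dom I, el_denote C x <-> el_denote D x.
Proof.
  induction 1; intro x; simpl; firstorder.
Qed.

Lemma robj_denote_aci (R S : robj NC NR NI) :
  robj_aci R S -> forall x y : dom I, robj_denote R x y <-> robj_denote S x y.
Proof.
  intros [T | T C D HCD] x y; simpl; [tauto |].
  pose proof (el_denote_aci HCD y); tauto.
Qed.

Lemma cobj_denote_aci (X Y : cobj NC NR NI) :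
  cobj_aci X Y -> forall x : dom I, cobj_denote X x <-> cobj_denote Y x.
Proof.
  intros [Z | C D H | R S H | R S H] x; simpl.
  - tauto.
  - exact (el_denote_aci H x).
  - split; intros [y Hy]; exists y; now apply (robj_denote_aci H).
  - split; intros [y Hy]; exists y; now apply (robj_denote_aci H).
Qed.

Variable O : sh_ontology NC NR NI.
Hypothesis model : is_model I O.

Lemma bar_ontology_satisfied ax :
  In ax (bar_ontology O) ->
  match ax with
  | GCI C D => forall x : dom I, el_denote C x -> el_denote D x
  | RoleIncl R P => forall x y : dom I, irole R x y -> irole P x y
  | Trans R => forall x y z : dom I, irole R x y -> irole R y z -> irole R x z
  | ConceptAssert a C => el_denote C (iindiv I a)
  | RoleAssert a b R => irole R (iindiv I a) (iindiv I b)
  end.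
Proof.
  intro H; apply in_map_iff in H; destruct H as [ax' [<- H]].
  apply model in H; destruct ax'; simpl in *; auto.
  - intros x; rewrite !el_denote_bar; auto.
  - now apply el_denote_bar.
Qed.

Lemma rarr_sound (R S : robj NC NR NI) :
  rarr (bar_ontology O) R S ->
  forall x y : dom I, robj_denote R x y -> robj_denote S x y.
Proof.
  induction 1 as [R R' S S' HR HS _ IH | | | | R S T _ IH1 _ IH2
                 | R S H | S H | a b R H | R C H]; intros x y; simpl; auto.
  - intro Hx; apply (robj_denote_aci HS), IH, (robj_denote_aci HR), Hx.
  - tauto.
  - exact (bar_ontology_satisfied H x y).
  - intros [z [H1 H2]]; exact (bar_ontology_satisfied H x z y H1 H2).
  - intros [-> ->]; exact (bar_ontology_satisfied H).
  - tauto.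
Qed.

Lemma rarr_name_sound (R S : NR) :
  rarr (bar_ontology O) (RName R) (RName S) ->
  forall x y : dom I, irole R x y -> irole S x y.
Proof. intros H x y; exact (rarr_sound H (x := x) (y := y)). Qed.

Lemma rarr_comp_sound (S : NR) :
  rarr (bar_ontology O) (RComp S) (RName S) ->
  forall x y z : dom I, irole S x y -> irole S y z -> irole S x z.
Proof.
  intros H x y z Hxy Hyz; apply (rarr_sound H); simpl; eauto.
Qed.

Lemma rarr_pair_sound (a b : NI) (R : NR) :
  rarr (bar_ontology O) (RPair a b) (RName R) ->
  irole R (iindiv I a) (iindiv I b).
Proof. intro H; apply (rarr_sound H); simpl; auto. Qed.

Lemma carr_sound (X Y : cobj NC NR NI) :
  carr (bar_ontology O) X Y ->
  forall x : dom I, cobj_denote X x -> cobj_denote Y x.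
Proof.
  induction 1; intros x Hx; simpl in *;
    repeat match goal with
    | H : rarr _ (RName _) (RName _) |- _ =>
        pose proof (rarr_name_sound H); clear H
    | H : rarr _ (RComp _) _ |- _ => pose proof (rarr_comp_sound H); clear H
    | H : rarr _ (RPair _ _) _ |- _ => pose proof (rarr_pair_sound H); clear H
    | H : rarr _ _ _ |- _ => pose proof (rarr_sound H); clear H
    | H : In _ _ |- _ => pose proof (bar_ontology_satisfied H); clear H
    | H : cobj_aci _ _ |- _ => pose proof (cobj_denote_aci H); clear H
    | H : carr _ _ _ |- _ => clear H
    | H : cob _ _ |- _ => clear H
    end; simpl in *; subst; firstorder eauto.
Qed.

End Soundness.

Theorem corollary1 (NC NR NI : Type) (O : sh_ontology NC NR NI) :
  nnf_ontology O -> sh_consistent O -> el_consistent (bar_ontology O).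
Proof.
  intros _ [I model] [a Ha].
  exact (carr_sound model Ha (x := iindiv I a) eq_refl).
Qed.
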